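(* Let $\mathcal{H}_1$ and $\mathcal{H}_2$ be two real Hilbert spaces, and let $C\subset\mathcal{H}_1$ and $Q\subset\mathcal{H}_2$ be nonempty, closed and convex subsets. Let $f:\mathcal{H}_1\to\mathbb{R}$ and $g:\mathcal{H}_2\to\mathbb{R}$ be two continuous functions. Let $\mathcal{B}_1:\mathcal{H}_1\to 2^{\mathcal{H}_1}$ and $\mathcal{B}_2:\mathcal{H}_2\to 2^{\mathcal{H}_2}$ be two strict weakly compact-valued and $H$-continuous mappings. Let $A:\mathcal{H}_1\to\mathcal{H}_2$ be a bounded linear operator. Then the split multivalued variational inequality problem (SMVIP) associated with these data is LP well-posed if and only if $$S(\epsilon)\neq\emptyset \quad \forall\,\epsilon>0 \quad\text{and}\quad \operatorname{diam}(S(\epsilon))\to 0 \text{ as } \epsilon\to 0.$$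
   Context: Data: real Hilbert spaces $\mathcal{H}_1,\mathcal{H}_2$; sets $C\subset\mathcal{H}_1$, $Q\subset\mathcal{H}_2$; functions $f:\mathcal{H}_1\to\mathbb{R}$, $g:\mathcal{H}_2\to\mathbb{R}$; multivalued mappings $\mathcal{B}_i:\mathcal{H}_i\to 2^{\mathcal{H}_i}$ ($i=1,2$); a bounded linear operator $A:\mathcal{H}_1\to\mathcal{H}_2$. The product $\mathcal{H}_1\times\mathcal{H}_2$ carries its usual Hilbert space structure. A multivalued mapping is strict if all its values are nonempty. It is weakly compact-valued if each of its values is a weakly compact set. Hausdorff metric: for nonempty sets $M,N$ in a Hilbert space, $d(a,N)=\inf_{b\in N}\|a-b\|$, $D(M,N)=\sup_{a\in M}d(a,N)$, $H(M,N)=\max\{D(M,N),D(N,M)\}$. A strict weakly compact-valued mapping $B:\mathcal{H}\to 2^{\mathcal{H}}$ is $H$-continuous if for every $x\in\mathcal{H}$ and every $\epsilon>0$ there is $\delta>0$ such that $H(B(x),B(y))<\epsilon$ for all $y\in\mathcal{H}$ with $\|x-y\|<\delta$. SMVIP: find $(x^*,y^* )\in\mathcal{H}_1\times\mathcal{H}_2$ for which there exists $(u^*,v^* )\in\mathcal{B}_1(x^* )\times\mathcal{B}_2(y^* )$ such that $x^*\in C$, $y^*\in Q$, $y^*=Ax^*$, $\langle u^*,x^*-x\rangle+f(x^* )-f(x)\le 0$ for all $x\in C$, and $\langle v^*,y^*-y\rangle+g(y^* )-g(y)\le 0$ for all $y\in Q$. Its solution set is denoted by $S$. A sequence $\{(x_n,y_n)\}\subset\mathcal{H}_1\times\mathcal{H}_2$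 is a generalized approximating sequence for SMVIP if there exist $u_n\in\mathcal{B}_1(x_n)$, $v_n\in\mathcal{B}_2(y_n)$ and real numbers $\epsilon_n>0$ with $\epsilon_n\to0$ such that, for every $n$, $d(x_n,C)\le\epsilon_n$, $d(y_n,Q)\le\epsilon_n$, $\|y_n-Ax_n\|\le\epsilon_n$, $\langle u_n,x_n-x\rangle+f(x_n)-f(x)\le\epsilon_n$ for all $x\in C$, and $\langle v_n,y_n-y\rangle+g(y_n)-g(y)\le\epsilon_n$ for all $y\in Q$. SMVIP is LP (Levitin-Polyak) well-posed if $S$ is a singleton and every generalized approximating sequence for SMVIP converges (in norm) to the unique solution. For $\epsilon>0$, $S(\epsilon)$ is the set of all $(z,w)\in\mathcal{H}_1\times\mathcal{H}_2$ such that $d(z,C)\le\epsilon$, $d(w,Q)\le\epsilon$, $\|w-Az\|\le\epsilon$, and there exist $u\in\mathcal{B}_1(z)$, $v\in\mathcal{B}_2(w)$ with $\langle u,z-x\rangle+f(z)-f(x)\le\epsilon$ for all $x\in C$ and $\langle v,w-y\rangle+g(w)-g(y)\le\epsilon$ for all $y\in Q$. The diameter of a set $M$ is $\operatorname{diam}(M)=\sup\{\|a-b\|:a,b\in M\}$ (possibly $+\infty$). *)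

(* Defs.v *)
From HB Require Import structures.
From mathcomp Require Import all_boot all_order all_algebra.
From mathcomp Require Import all_classical all_reals all_analysis.

Set Implicit Arguments.
Unset Strict Implicit.
Unset Printing Implicit Defensive.

Import Order.TTheory GRing.Theory Num.Theory.
Import numFieldNormedType.Exports.

Local Open Scope classical_set_scope.
Local Open Scope ring_scope.

HB.mixin Record NormedModule_isHilbert (R : realType) H
    & CompleteNormedModule R H := {
  inner : {dot H for (@idfun R)} ;
  inner_normE : forall x : H, inner x x = `|x| ^+ 2
}.

#[short(type="hilbertType")]
HB.structure Definition Hilbert (R : realType) :=
  {H of CompleteNormedModule R H & NormedModule_isHilbert R H}.

Section WeakTopology.
Context {R : realType}.

Definition dual (V : normedModType R) : Type :=
  {phi : {linear V -> R^o} | continuous phi}.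

Definition weak_eval (V : normedModType R) (x : V) : {ptws dual V -> R^o} :=
  fun phi => sval phi x.

(* The initial topology of weak_eval is the coarsest one making every continuous
   linear functional on V continuous. *)
Definition weakly_compact (V : normedModType R) (M : set V) : Prop :=
  compact (M : set (initial_topology (@weak_eval V))).

End WeakTopology.

Section Multimaps.
Context {R : realType} {H : hilbertType R}.
Implicit Types (M N : set H) (B : H -> set H).

Definition dist_set (a : H) N : \bar R := ereal_inf [set `|a - b|%:E | b in N].

Definition excess M N : \bar R := ereal_sup [set dist_set a N | a in M].

Definition hausdorff_dist M N : \bar R := maxe (excess M N) (excess N M).

Definition strict_multimap B := forall x, B x !=set0.

Definition weakly_compact_valued B := forall x, weakly_compact (B x).

Definition H_continuous B := forall (x : H) (e : R), 0 < e ->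
  exists2 d : R, 0 < d &
    forall y : H, `|x - y| < d -> (hausdorff_dist (B x) (B y) < e%:E)%E.

End Multimaps.

Section ProductHilbert.
Context {R : realType} {H1 H2 : hilbertType R}.
Implicit Types p q : H1 * H2.

Definition prod_inner p q : R := inner p.1 q.1 + inner p.2 q.2.

(* The library's norm on a product is the max norm; this is the Hilbert one. *)
Definition prod_hnorm p : R := Num.sqrt (prod_inner p p).

(* The supremum is taken in \bar R: -oo on the empty set, +oo when unbounded. *)
Definition diam (M : set (H1 * H2)) : \bar R :=
  ereal_sup [set (prod_hnorm (a - b))%:E | a in M & b in M].

End ProductHilbert.

Section SMVIP.
Context {R : realType} {H1 H2 : hilbertType R}.
Variables (C : set H1) (Q : set H2) (f : H1 -> R) (g : H2 -> R).
Variables (B1 : H1 -> set H1) (B2 : H2 -> set H2) (A : {linear H1 -> H2}).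

Definition smvip_sol : set (H1 * H2) := [set p : H1 * H2 |
  exists u v, [/\ B1 p.1 u, B2 p.2 v,
    [/\ C p.1, Q p.2 & p.2 = A p.1],
    (forall x, C x -> inner u (p.1 - x) + f p.1 - f x <= 0) &
    (forall y, Q y -> inner v (p.2 - y) + g p.2 - g y <= 0)]].

Definition generalized_approximating (z : nat -> H1 * H2) : Prop :=
  exists (u : nat -> H1) (v : nat -> H2) (e : nat -> R),
    [/\ (forall n, B1 (z n).1 (u n)), (forall n, B2 (z n).2 (v n)),
        (forall n, 0 < e n), e n @[n --> \oo] --> (0 : R) &
        forall n,
          [/\ (dist_set (z n).1 C <= (e n)%:E)%E,
              (dist_set (z n).2 Q <= (e n)%:E)%E,
              `|(z n).2 - A (z n).1| <= e n,
              (forall x, C x ->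
                 inner (u n) ((z n).1 - x) + f (z n).1 - f x <= e n) &
              (forall y, Q y ->
                 inner (v n) ((z n).2 - y) + g (z n).2 - g y <= e n)]].

Definition LP_well_posed : Prop :=
  exists p : H1 * H2, smvip_sol = [set p] /\
    forall z, generalized_approximating z ->
      prod_hnorm (z n - p) @[n --> \oo] --> (0 : R).

Definition smvip_approx (e : R) : set (H1 * H2) := [set p : H1 * H2 |
  [/\ (dist_set p.1 C <= e%:E)%E, (dist_set p.2 Q <= e%:E)%E,
      `|p.2 - A p.1| <= e &
      exists u v, [/\ B1 p.1 u, B2 p.2 v,
        (forall x, C x -> inner u (p.1 - x) + f p.1 - f x <= e) &
        (forall y, Q y -> inner v (p.2 - y) + g p.2 - g y <= e)]]].

End SMVIP.

(* Main.v *)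
Require Import Defs.
From HB Require Import structures.
From mathcomp Require Import all_boot all_order all_algebra.
From mathcomp Require Import all_classical all_reals all_analysis.
From mathcomp Require Import ring lra.

Import Order.TTheory GRing.Theory Num.Theory.
Import numFieldNormedType.Exports.

Local Open Scope classical_set_scope.
Local Open Scope ring_scope.

(** The heart of the matter is the passage to the limit
    ([generalized_approximating_limit]): the limit of a norm-convergent
    generalized approximating sequence solves the problem. The metric
    constraints pass to the limit because the two sets are closed and [A] is
    continuous. For the variational inequalities ([mvi_limit]), let
    x_n --> x with u_n in B(x_n). By H-continuity there are w_n in B(x) with
    |u_n - w_n| --> 0. The set B(x) is weakly compact, hence bounded (uniform
    boundedness principle), and the sequence w_n has a weak cluster point u in
    B(x). In the decomposition
      <w_n, x - y> = <w_n, x - x_n> + <w_n - u_n, x_n - y> + <u_n, x_n - y>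
    the first two terms tend to 0, and the third one is bounded by
    e_n + f(y) - f(x_n). Since <w_n, x - y> comes arbitrarily close to
    <u, x - y>, this gives <u, x - y> <= f(y) - f(x), with the same u for all y.

    If the diameters of S(e) tend to 0, every generalized approximating
    sequence is Cauchy, hence converges, and its limit is a solution
    ([generalized_approximating_cvg]). One such sequence exists as soon as all
    the S(e) are nonempty, and the solution is unique because solutions lie in
    every S(e).

    Conversely, if the problem is well-posed, the S(e) contain the solution. If
    their diameters did not tend to 0, one could choose two points of S(1/(n+1))
    at distance more than a fixed r > 0 for every n; the two sequences so
    obtained are generalized approximating, so both converge to the solution,
    which is absurd ([LP_well_posed_approx_small]). *)

(** * Inner products and weak compactness *)

Lemma ptws_eval_continuous {I : Type} {T : topologicalType} (i : I) :
  continuous (fun h : {ptws I -> T} => h i).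
Proof.
move=> h A hA; have /cvg_sup/(_ i) : h --> h by exact: cvg_id.
apply; exact: (@initial_continuous _ _ (fun k : I -> T => k i) h A hA).
Qed.

Section InnerProduct.
Set Implicit Arguments.
Unset Strict Implicit.
Context {R : realType} {H : hilbertType R}.
Implicit Types u v w : H.

Lemma innerC u v : inner u v = inner v u.
Proof. by rewrite (hermC (@inner R H)) expr0 mul1r. Qed.

Lemma innerBr u v w : inner u (v - w) = inner u v - inner u w.
Proof. exact: linearBr. Qed.

Lemma innerBl u v w : inner (u - v) w = inner u w - inner v w.
Proof. exact: linearBl. Qed.

Lemma innerZr (a : R) u v : inner u (a *: v) = a * inner u v.
Proof. exact: linearZr_LR. Qed.

Lemma innerZl (a : R) u v : inner (a *: u) v = a * inner u v.
Proof. by rewrite innerC innerZr innerC. Qed.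

(** The Cauchy-Schwarz inequality. *)
Lemma ler_norm_inner u v : `|inner u v| <= `|u| * `|v|.
Proof.
have [->|v0] := eqVneq v 0.
  by rewrite (linear0r (@inner R H) u) !normr0 mulr0.
have vv : 0 < `|v| ^+ 2 by rewrite exprn_gt0 ?normr_gt0.
rewrite -ler_sqr ?nnegrE ?mulr_ge0// exprMn real_normK ?num_real//.
rewrite -subr_ge0 -(pmulr_rge0 _ vv).
(* Expand the squared norm of |v|^2 u - <u, v> v. *)
have : 0 <= `|(`|v| ^+ 2) *: u - inner u v *: v| ^+ 2 by rewrite exprn_ge0.
rewrite -inner_normE !innerBl !innerBr !innerZl !innerZr.
rewrite !inner_normE (innerC v u).
by lra.
Qed.


Lemma inner_continuous u : continuous (inner u : {linear H -> R^o}).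
Proof.
apply/linear_bounded_continuous/linear_boundedP.
near=> r => v; apply: (le_trans (ler_norm_inner u v)).
by rewrite ler_wpM2r//; near: r; exact: nbhs_pinfty_ge.
Unshelve. all: by end_near. Qed.

(** The continuous linear functional [inner u]. *)
Definition inner_dual u : dual H := exist _ _ (@inner_continuous u).

Lemma weak_inner_continuous u :
  continuous (fun v : initial_topology (@weak_eval R H) => inner u v : R^o).
Proof.
move=> v.
apply: (@continuous_comp _ _ _ (@weak_eval R H : initial_topology _ -> _)
  (fun h : {ptws dual H -> R^o} => h (inner_dual u))).
- exact: initial_continuous.
- exact: ptws_eval_continuous.
Qed.

(** The functionals [inner u], for u in K, are pointwise bounded since weakly
    continuous functions are bounded on K; the uniform boundedness principle
    bounds them on the unit ball, and evaluating at u / |u| bounds |u|. *)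
Lemma weakly_compact_bounded (K : set H) : weakly_compact K ->
  exists M : R, forall u, K u -> `|u| <= M.
Proof.
move=> Kcompact.
pose F : set (H -> R^o) := [set (inner u : H -> R^o) | u in K].
have [|x|M FM] := @Banach_Steinhauss R H R^o F _ _ 1.
- move=> _ [u _ <-]; split; last exact: linearP.
  by move=> r; exists (`|u| * r) => x xr;
    rewrite (le_trans (ler_norm_inner u x))// ler_wpM2l.
- have : compact
      ((fun v : initial_topology (@weak_eval R H) => inner x v : R^o) @` K).
    apply: (@continuous_compact (initial_topology (@weak_eval R H)) R^o) Kcompact.
    by apply: continuous_subspaceT; exact: weak_inner_continuous.
  move=> /compact_bounded /pinfty_ex_gt0 [M M0 KM].
  exists M => _ [u Ku <-]; rewrite innerC; apply: KM.
  by exists u.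
exists M => u Ku.
have [->|u0] := eqVneq u 0.
  rewrite normr0; apply: le_trans (FM _ _ 0 _); rewrite ?normr0//.
  by exists u.
have nu : 0 < `|u| by rewrite normr_gt0.
have := FM (inner u) _ (`|u|^-1 *: u); rewrite innerZr inner_normE.
rewrite expr2 mulKf ?gt_eqF// normr_id; apply; first by exists u.
by rewrite normrZ normfV normr_id mulVf ?gt_eqF.
Qed.

(** A sequence in a weakly compact set has a weak cluster point u. The
    conclusion tests u against a single direction z at a time, frequently along
    the sequence; u itself does not depend on z. *)
Lemma weakly_compact_cluster (K : set H) (w : nat -> H) :
  weakly_compact K -> (forall n, K (w n)) ->
  exists2 u, K u & forall z (e : R) (P : set nat), 0 < e ->
    (\forall n \near \oo, P n) ->
    exists2 n, P n & `|inner u z - inner (w n) z| < e.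
Proof.
move=> Kcompact Kw.
have [|u [Ku uw]] := Kcompact (w @ \oo) _.
  by exists 0%N => // n _; exact: Kw.
exists u => // z e P e0 Pn.
have nu := @weak_inner_continuous z u _ (nbhsx_ballx (inner z u : R^o) e e0).
have [|v [[n Pn' <-]]] := uw (w @` P) _ _ nu.
  by apply: filterS Pn => n Pn; exists n.
by rewrite /ball/= => ?; exists n => //; rewrite !(innerC _ z).
Qed.

End InnerProduct.

(** * Passage to the limit in a variational inequality *)

Section Multimaps.
Set Implicit Arguments.
Unset Strict Implicit.
Context {R : realType} {H : hilbertType R}.
Implicit Types (M N : set H) (B : H -> set H).

Lemma dist_set_ge0 (a : H) N : (0%:E <= dist_set a N)%E.
Proof. by apply: le_ereal_inf_tmp => _ [b _ <-]; rewrite lee_fin. Qed.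

Lemma dist_set_lt (a : H) N (r : R) : (dist_set a N < r%:E)%E ->
  exists2 b, N b & `|a - b| < r.
Proof. by move=> /ereal_inf_lt [_ [b Nb <-]]; rewrite lte_fin; exists b. Qed.

Lemma dist_set_hausdorff a M N : M a -> (dist_set a N <= hausdorff_dist M N)%E.
Proof.
move=> Ma; rewrite /hausdorff_dist le_max; apply/orP; left.
by apply: ereal_sup_ubound; exists a.
Qed.

Lemma closed_dist_set_cvg0 N (x_ : nat -> H) (x : H) (e_ : nat -> R) :
  closed N -> (forall n, dist_set (x_ n) N <= (e_ n)%:E)%E ->
  e_ n @[n --> \oo] --> (0 : R) -> x_ n @[n --> \oo] --> x -> N x.
Proof.
move=> Nclosed xN e0 xx; apply: Nclosed => U /nbhs_ballP[_/posnumP[r] rU].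
have h : 0 < r%:num / 2 by [].
near \oo => n.
have [|b Nb nb] := @dist_set_lt (x_ n) N (r%:num / 2).
  apply: le_lt_trans (xN n) _; rewrite lte_fin.
  by near: n; exact: (cvgr_lt _ e0).
exists b; split => //; apply: rU; rewrite -ball_normE/= (splitr r%:num).
rewrite -(subrK (x_ n) x) -addrA; apply: (le_lt_trans (ler_normD _ _)).
by apply: ltrD => //; near: n; move/cvgrPdist_lt : xx; exact.
Unshelve. all: by end_near. Qed.

(** H-continuity in sequential form: a selection along a convergent sequence is
    asymptotically close to a sequence of points of the limit value. *)
Lemma H_continuous_selection B (x : H) (x_ u_ : nat -> H) :
  strict_multimap B -> H_continuous B ->
  x_ n @[n --> \oo] --> x -> (forall n, B (x_ n) (u_ n)) ->
  exists2 w : nat -> H, (forall n, B x (w n)) &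
    `|u_ n - w n| @[n --> \oo] --> (0 : R).
Proof.
move=> Bstrict Bcont xx Bu.
have dfin n : dist_set (u_ n) (B x) \is a fin_num.
  have [b Bb] := Bstrict x.
  rewrite ge0_fin_numE ?dist_set_ge0//.
  apply: (@le_lt_trans _ _ `|u_ n - b|%:E); last exact: ltry.
  by apply: ereal_inf_lbound; exists b.
(* The infimum need not be attained: w n is nearest to u n up to 1 / (n + 1). *)
have /choice[w wP] n : exists w, B x w /\
    `|u_ n - w| < fine (dist_set (u_ n) (B x)) + n.+1%:R^-1.
  have n0 : 0 < n.+1%:R^-1 :> R by [].
  have [_ [w Bw <-]] := lb_ereal_inf_adherent n0 (dfin n).
  by rewrite -/(dist_set _ _) -(fineK (dfin n)) -EFinD lte_fin => ?; exists w.
exists w => [n|]; first by case: (wP n).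
apply/cvgr0Pnorm_lt => e e0.
have e2 : 0 < e / 2 by rewrite divr_gt0.
have [d d0 Bd] := Bcont x _ e2.
near=> n; rewrite normr_id (splitr e).
apply: lt_trans (wP n).2 _; apply: ltrD; last first.
  by near: n; exact: near_infty_natSinv_lt (PosNum e2).
rewrite -lte_fin fineK//; apply: (le_lt_trans (dist_set_hausdorff (B x) (Bu n))).
rewrite /hausdorff_dist maxC; apply: Bd; near: n.
by move/cvgrPdist_lt : xx; exact.
Unshelve. all: by end_near. Qed.

(** Approximate solutions of a multivalued variational inequality, with errors
    tending to 0, can only converge to an exact solution. *)
Lemma mvi_limit (C : set H) (f : H -> R) B (x : H) (x_ u_ : nat -> H)
    (e_ : nat -> R) :
  continuous f -> strict_multimap B -> weakly_compact_valued B ->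
  H_continuous B -> x_ n @[n --> \oo] --> x -> e_ n @[n --> \oo] --> (0 : R) ->
  (forall n, B (x_ n) (u_ n)) ->
  (forall n y, C y -> inner (u_ n) (x_ n - y) + f (x_ n) - f y <= e_ n) ->
  exists2 u, B x u & forall y, C y -> inner u (x - y) + f x - f y <= 0.
Proof.
move=> fcont Bstrict Bwcompact Bcont xx e0 Bu uC.
have [w Bw uw0] := H_continuous_selection Bstrict Bcont xx Bu.
have [M BM] := weakly_compact_bounded (Bwcompact x).
have [u Bxu uw] := weakly_compact_cluster (Bwcompact x) Bw.
exists u => // y Cy.
(* By the three-term decomposition, <w n, x - y> + f x - f y <= c n. *)
pose c n : R :=
  M * `|x - x_ n| + `|u_ n - w n| * `|x_ n - y| + e_ n + (f x - f (x_ n)).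
have c0 : c n @[n --> \oo] --> (0 : R).
  have -> : (0 : R) = M * `|x - x| + 0 * `|x - y| + 0 + (f x - f x).
    by rewrite !subrr normr0; ring.
  apply: cvgD; [apply: cvgD => //; apply: cvgD|].
  - by apply: cvgMr; apply: cvg_norm; apply: cvgB => //; exact: cvg_cst.
  - by apply: cvgM => //; apply: cvg_norm; apply: cvgB => //; exact: cvg_cst.
  - by apply: cvgB; [exact: cvg_cst|exact: cvg_comp xx (fcont x)].
apply/ler_addgt0Pr => e egt0; rewrite add0r.
have e2 : 0 < e / 2 by rewrite divr_gt0.
have [n cn /ltr_normlW un] := uw (x - y) _ _ e2 (cvgr_lt _ c0 _ e2).
have un' : inner (u_ n) (x_ n - y) + f (x_ n) - f y <= e_ n by exact: uC.
have wx : inner (w n) (x - x_ n) <= M * `|x - x_ n|.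
  apply: (le_trans (ler_norm _)); apply: (le_trans (ler_norm_inner _ _)).
  by rewrite ler_wpM2r// BM.
have wu : inner (w n - u_ n) (x_ n - y) <= `|u_ n - w n| * `|x_ n - y|.
  by apply: (le_trans (ler_norm _)); rewrite (distrC (u_ n)) ler_norm_inner.
move: cn un un' wx wu; rewrite /c/= !innerBr !innerBl; lra.
Qed.

End Multimaps.

(** * The Hilbert norm and diameters in the product *)

Section ProductHilbert.
Context {R : realType} {H1 H2 : hilbertType R}.
Implicit Types p q : H1 * H2.
Set Implicit Arguments.
Unset Strict Implicit.

Lemma prod_hnormE p : prod_hnorm p = Num.sqrt (`|p.1| ^+ 2 + `|p.2| ^+ 2).
Proof. by rewrite /prod_hnorm /prod_inner !inner_normE. Qed.

Lemma prod_hnorm_ge0 p : 0 <= prod_hnorm p.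
Proof. exact: sqrtr_ge0. Qed.

Lemma ler_norm1_prod_hnorm p : `|p.1| <= prod_hnorm p.
Proof.
by rewrite prod_hnormE -[leLHS]normr_id -sqrtr_sqr ler_wsqrtr// lerDl exprn_ge0.
Qed.

Lemma ler_norm2_prod_hnorm p : `|p.2| <= prod_hnorm p.
Proof.
by rewrite prod_hnormE -[leLHS]normr_id -sqrtr_sqr ler_wsqrtr// lerDr exprn_ge0.
Qed.

Lemma ler_prod_hnorm p : prod_hnorm p <= `|p.1| + `|p.2|.
Proof.
rewrite prod_hnormE -[leRHS]ger0_norm ?addr_ge0// -sqrtr_sqr ler_wsqrtr//.
by rewrite sqrrD addrAC lerDl mulrn_wge0// mulr_ge0.
Qed.

Lemma prod_hnorm_subr_eq0 p q : prod_hnorm (p - q) <= 0 -> p = q.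
Proof.
move=> pq0; case: p q pq0 => [p1 p2] [q1 q2] pq0; congr (_, _);
  apply/eqP; rewrite -subr_eq0 -normr_le0; apply: le_trans pq0.
- exact: (ler_norm1_prod_hnorm ((p1, p2) - (q1, q2))).
- exact: (ler_norm2_prod_hnorm ((p1, p2) - (q1, q2))).
Qed.

Lemma cvg_prod_hnorm0 (z : nat -> H1 * H2) p :
  (z n).1 @[n --> \oo] --> p.1 -> (z n).2 @[n --> \oo] --> p.2 ->
  prod_hnorm (z n - p) @[n --> \oo] --> (0 : R).
Proof.
move=> z1 z2.
have h : `|(z n).1 - p.1| + `|(z n).2 - p.2| @[n --> \oo] --> (0 : R).
  have -> : (0 : R) = `|p.1 - p.1| + `|p.2 - p.2|.
    by rewrite !subrr !normr0 addr0.
  by apply: cvgD; apply: cvg_norm; apply: cvgB => //; exact: cvg_cst.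
apply: squeeze_cvgr (cvg_cst (0 : R)) h.
by near=> n; rewrite prod_hnorm_ge0/=; exact: (ler_prod_hnorm (z n - p)).
Unshelve. all: by end_near. Qed.

(** A triangle inequality up to a factor 2, which is enough for limits. *)
Lemma ler_prod_hnorm_dist2 p q r :
  prod_hnorm (p - q) <= (prod_hnorm (p - r) + prod_hnorm (q - r)) *+ 2.
Proof.
apply: (le_trans (ler_prod_hnorm _)); rewrite mulr2n.
have h1 : `|(p - q).1| <= `|(p - r).1| + `|(q - r).1|.
  by rewrite /= (distrC q.1); exact: ler_distD.
have h2 : `|(p - q).2| <= `|(p - r).2| + `|(q - r).2|.
  by rewrite /= (distrC q.2); exact: ler_distD.
apply: lerD; [apply: (le_trans h1)|apply: (le_trans h2)]; apply: lerD;
  by [exact: ler_norm1_prod_hnorm|exact: ler_norm2_prod_hnorm].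
Qed.

Lemma diam_leP (M : set (H1 * H2)) (r : R) :
  (diam M <= r%:E)%E <-> forall p q, M p -> M q -> prod_hnorm (p - q) <= r.
Proof.
split => [Mr p q Mp Mq|Mr].
  rewrite -lee_fin; apply: le_trans Mr; apply: ereal_sup_ubound.
  by exists p => //; exists q.
by apply: ge_ereal_sup => _ [p Mp [q Mq <-]]; rewrite lee_fin Mr.
Qed.

Lemma diam_ge0 (M : set (H1 * H2)) : M !=set0 -> (0%:E <= diam M)%E.
Proof.
move=> [p Mp]; apply: (@le_trans _ _ (prod_hnorm (p - p))%:E).
  by rewrite lee_fin prod_hnorm_ge0.
by apply: ereal_sup_ubound; exists p => //; exists p.
Qed.

(** For an increasing family of nonempty sets, the diameters tend to 0 as
    soon as, for every r > 0, some member has diameter at most r. *)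
Lemma diam_cvg0P (M : R -> set (H1 * H2)) :
  (forall e, 0 < e -> M e !=set0) ->
  (forall e e', e <= e' -> M e `<=` M e') ->
  diam (M e) @[e --> (0 : R)^'+] --> 0%:E <->
  forall r : R, 0 < r -> exists2 e : R, 0 < e &
    forall p q, M e p -> M e q -> prod_hnorm (p - q) <= r.
Proof.
move=> Mneq0 Mmono; split => [/fine_cvgP[Mfin /cvgr0Pnorm_lt M0] r r0|M0].
  near (0 : R)^'+ => e; have e0 : 0 < e by near: e; exact: nbhs_right_gt.
  exists e => //; apply/diam_leP.
  rewrite -(@fineK _ (diam (M e))) ?lee_fin; last by near: e.
  by apply: le_trans (ler_norm _) _; apply: ltW; near: e; exact: M0.
have Mle r : 0 < r -> \forall e \near (0 : R)^'+, (0 <= diam (M e) <= r%:E)%E.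
  move=> /M0[d d0 Md]; near=> e.
  rewrite diam_ge0/=; last by apply: Mneq0; near: e; exact: nbhs_right_gt.
  have ed : e <= d by near: e; exact: nbhs_right_le.
  by apply/diam_leP => p q ? ?; apply: Md; exact: Mmono ed _ _.
apply/fine_cvgP; split.
  near=> e; have /andP[Me0 Me1] : (0 <= diam (M e) <= 1%:E)%E.
    by near: e; exact: Mle.
  by rewrite ge0_fin_numE// (le_lt_trans Me1)// ltry.
apply/cvgr0Pnorm_le => r r0; near=> e.
have /andP[Me0 Mer] : (0 <= diam (M e) <= r%:E)%E by near: e; exact: Mle.
rewrite /= ger0_norm ?fine_ge0// -lee_fin fineK// ge0_fin_numE//.
by rewrite (le_lt_trans Mer)// ltry.
Unshelve. all: by end_near. Qed.

End ProductHilbert.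

(** * Approximate solutions of the split problem *)

Section SMVIP.
Context {R : realType} {H1 H2 : hilbertType R}.
Variables (C : set H1) (Q : set H2) (f : H1 -> R) (g : H2 -> R).
Variables (B1 : H1 -> set H1) (B2 : H2 -> set H2) (A : {linear H1 -> H2}).
Set Implicit Arguments.
Unset Strict Implicit.

Let S := smvip_sol C Q f g B1 B2 A.
Let Sapp := smvip_approx C Q f g B1 B2 A.

Lemma smvip_approx_mono (e e' : R) : e <= e' -> Sapp e `<=` Sapp e'.
Proof.
move=> ee' p [pC pQ pA [u [v [B1u B2v uC vQ]]]]; split.
- by apply: le_trans pC _; rewrite lee_fin.
- by apply: le_trans pQ _; rewrite lee_fin.
- exact: le_trans ee'.
- exists u, v; split => // [x /uC|y /vQ] h; exact: le_trans ee'.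
Qed.

Lemma smvip_sol_approx (e : R) : 0 < e -> S `<=` Sapp e.
Proof.
move=> e0 p [u [v [B1u B2v [pC pQ pA] uC vQ]]]; split.
- apply: ge_ereal_inf; exists 0%:E; rewrite ?lee_fin ?ltW//.
  by exists p.1; rewrite // subrr normr0.
- apply: ge_ereal_inf; exists 0%:E; rewrite ?lee_fin ?ltW//.
  by exists p.2; rewrite // subrr normr0.
- by rewrite pA subrr normr0 ltW.
- exists u, v; split => // [x /uC|y /vQ] h; exact: le_trans (ltW e0).
Qed.

(** A sequence is generalized approximating exactly when its terms lie in
    S(e_n) for some positive e_n tending to 0. *)
Lemma generalized_approximatingP (z : nat -> H1 * H2) :
  generalized_approximating C Q f g B1 B2 A z <->
  exists e : nat -> R, [/\ forall n, 0 < e n, e n @[n --> \oo] --> (0 : R) &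
    forall n, Sapp (e n) (z n)].
Proof.
split => [[u [v [e [B1u B2v e0 ecvg ze]]]]|[e [e0 ecvg ze]]].
  exists e; split => // n; have [zC zQ zA uC vQ] := ze n.
  by split => //; exists (u n), (v n).
have /choice[u uP] n : exists u, B1 (z n).1 u /\
    forall x, C x -> inner u ((z n).1 - x) + f (z n).1 - f x <= e n.
  by have [_ _ _ [u [v []]]] := ze n; exists u.
have /choice[v vP] n : exists v, B2 (z n).2 v /\
    forall y, Q y -> inner v ((z n).2 - y) + g (z n).2 - g y <= e n.
  by have [_ _ _ [u' [v []]]] := ze n; exists v.
exists u, v, e; split => // n; first by case: (uP n).
  by case: (vP n).
have [zC zQ zA _] := ze n; split => //; first by case: (uP n).
by case: (vP n).
Qed.

Hypotheses (C_closed : closed C) (Q_closed : closed Q)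
  (f_cont : continuous f) (g_cont : continuous g)
  (B1_strict : strict_multimap B1) (B1_wcompact : weakly_compact_valued B1)
  (B1_cont : H_continuous B1)
  (B2_strict : strict_multimap B2) (B2_wcompact : weakly_compact_valued B2)
  (B2_cont : H_continuous B2)
  (A_bounded : exists K : R, forall x : H1, `|A x| <= K * `|x|).

Lemma bounded_linear_cvg (x_ : nat -> H1) (x : H1) :
  x_ n @[n --> \oo] --> x -> A (x_ n) @[n --> \oo] --> A x.
Proof.
have [K AK] := A_bounded.
have Acont : continuous A.
  apply/linear_bounded_continuous/linear_boundedP.
  exists K; split; first exact: num_real.
  by move=> r /ltW Kr y; apply: (le_trans (AK y)); rewrite ler_wpM2r.
by move=> xx; exact: cvg_comp xx (Acont x).
Qed.

Lemma generalized_approximating_limit (z : nat -> H1 * H2) (p : H1 * H2) :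
  generalized_approximating C Q f g B1 B2 A z ->
  (z n).1 @[n --> \oo] --> p.1 -> (z n).2 @[n --> \oo] --> p.2 -> S p.
Proof.
move=> [u [v [e [B1u B2v e_gt0 e0 ze]]]] z1 z2.
have [|a B1a aC] :=
  mvi_limit (C := C) f_cont B1_strict B1_wcompact B1_cont z1 e0 B1u.
  by move=> n; case: (ze n).
have [|b B2b bQ] :=
  mvi_limit (C := Q) g_cont B2_strict B2_wcompact B2_cont z2 e0 B2v.
  by move=> n; case: (ze n).
exists a, b; split => //; split.
- by apply: (closed_dist_set_cvg0 C_closed _ e0 z1) => n; case: (ze n).
- by apply: (closed_dist_set_cvg0 Q_closed _ e0 z2) => n; case: (ze n).
- apply/eqP; rewrite -subr_eq0 -normr_le0.
  apply: (ler_cvg_to (f := fun n => `|(z n).2 - A (z n).1|) _ e0);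
    last by near=> n; case: (ze n).
  by apply: cvg_norm; apply: cvgB => //; exact: bounded_linear_cvg.
Unshelve. all: by end_near. Qed.

(** When S(e) is arbitrarily small in diameter for suitable e, a generalized
    approximating sequence, being eventually in each S(e), is Cauchy;
    its limit is a solution. *)
Lemma generalized_approximating_cvg (z : nat -> H1 * H2) :
  (forall r : R, 0 < r -> exists2 e : R, 0 < e &
    forall p q, Sapp e p -> Sapp e q -> prod_hnorm (p - q) <= r) ->
  generalized_approximating C Q f g B1 B2 A z ->
  exists2 p, S p & prod_hnorm (z n - p) @[n --> \oo] --> (0 : R).
Proof.
move=> small zapp.
have zclose r : 0 < r ->
    exists N, \forall n \near \oo, prod_hnorm (z N - z n) < r.
  move=> r0; have r2 : 0 < r / 2 by rewrite divr_gt0.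
  have [d d0 Sd] := small _ r2.
  have /generalized_approximatingP[e [_ e0 ze]] := zapp.
  have zd : \forall n \near \oo, Sapp d (z n).
    near=> n; apply: smvip_approx_mono (ze n).
    by near: n; exact: (cvgr_le _ e0).
  have [N zN] := filter_ex zd; exists N; near=> n.
  apply: le_lt_trans (Sd _ _ zN _) _; first by near: n.
  by rewrite ltr_pdivrMr// ltr_pMr// ltr1n.
have [z1 z2] : cvgn (fun n => (z n).1) /\ cvgn (fun n => (z n).2).
  split; apply/cauchy_cvgP/cauchyP => r /zclose[N zN].
  - exists (z N).1; apply: filterS zN => n; rewrite -ball_normE/=.
    exact: (le_lt_trans (ler_norm1_prod_hnorm (z N - z n))).
  - exists (z N).2; apply: filterS zN => n; rewrite -ball_normE/=.
    exact: (le_lt_trans (ler_norm2_prod_hnorm (z N - z n))).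
exists (limn (fun n => (z n).1), limn (fun n => (z n).2)).
  by apply: (generalized_approximating_limit zapp); [exact: z1|exact: z2].
by apply: cvg_prod_hnorm0; [exact: z1|exact: z2].
Unshelve. all: by end_near. Qed.

(** Otherwise two sequences of approximate solutions would stay r apart while
    both converge to the solution. *)
Lemma LP_well_posed_approx_small (r : R) :
  LP_well_posed C Q f g B1 B2 A -> 0 < r ->
  exists2 e : R, 0 < e &
    forall p q, Sapp e p -> Sapp e q -> prod_hnorm (p - q) <= r.
Proof.
move=> [s [_ wp]] r0; apply: contrapT => nsmall.
have inv0 : n.+1%:R^-1 @[n --> \oo] --> (0 : R) by exact: cvg_harmonic.
have /choice[ab abP] n : exists ab : (H1 * H2) * (H1 * H2),
    [/\ Sapp n.+1%:R^-1 ab.1, Sapp n.+1%:R^-1 ab.2 &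
        r < prod_hnorm (ab.1 - ab.2)].
  apply: contrapT => nab; apply: nsmall; exists n.+1%:R^-1 => // p q Sp Sq.
  by rewrite leNgt; apply/negP => pq; apply: nab; exists (p, q).
have a0 : prod_hnorm ((ab n).1 - s) @[n --> \oo] --> (0 : R).
  apply: wp; apply/generalized_approximatingP; exists (fun n => n.+1%:R^-1).
  by split => // n; case: (abP n).
have b0 : prod_hnorm ((ab n).2 - s) @[n --> \oo] --> (0 : R).
  apply: wp; apply/generalized_approximatingP; exists (fun n => n.+1%:R^-1).
  by split => // n; case: (abP n).
have r4 : 0 < r / 4 by rewrite divr_gt0.
have [n [an bn]] := filter_ex (filterI (cvgr_lt _ a0 _ r4) (cvgr_lt _ b0 _ r4)).
have [_ _] := abP n; have := ler_prod_hnorm_dist2 (ab n).1 (ab n).2 s.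
by move: an bn; rewrite /= mulr2n; lra.
Qed.

End SMVIP.

(** * Characterization of well-posedness *)

Theorem theorem6 (R : realType) (H1 H2 : hilbertType R)
    (C : set H1) (Q : set H2) (f : H1 -> R) (g : H2 -> R)
    (B1 : H1 -> set H1) (B2 : H2 -> set H2) (A : {linear H1 -> H2})
    (C_neq0 : C !=set0) (C_closed : closed C)
    (C_convex : convex_set (C : set (convex_lmodType H1)))
    (Q_neq0 : Q !=set0) (Q_closed : closed Q)
    (Q_convex : convex_set (Q : set (convex_lmodType H2)))
    (f_cont : continuous f) (g_cont : continuous g)
    (B1_strict : strict_multimap B1) (B1_wcompact : weakly_compact_valued B1)
    (B1_cont : H_continuous B1)
    (B2_strict : strict_multimap B2) (B2_wcompact : weakly_compact_valued B2)
    (B2_cont : H_continuous B2)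
    (A_bounded : exists K : R, forall x : H1, `|A x| <= K * `|x|) :
  LP_well_posed C Q f g B1 B2 A <->
  (forall e : R, 0 < e -> smvip_approx C Q f g B1 B2 A e !=set0) /\
  diam (smvip_approx C Q f g B1 B2 A e) @[e --> (0 : R)^'+] --> 0%:E.
Proof.
have approx_mono := @smvip_approx_mono R H1 H2 C Q f g B1 B2 A.
have approx_cvg := @generalized_approximating_cvg R H1 H2 C Q f g B1 B2 A
  C_closed Q_closed f_cont g_cont B1_strict B1_wcompact B1_cont
  B2_strict B2_wcompact B2_cont A_bounded.
split => [wp|[approx_neq0 /diam_cvg0P small]].
  have approx_neq0 (e : R) : 0 < e -> smvip_approx C Q f g B1 B2 A e !=set0.
    move=> e0; have [p [Sp _]] := wp; exists p; apply: smvip_sol_approx => //.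
    by rewrite Sp.
  split => //; apply/diam_cvg0P => // r; exact: LP_well_posed_approx_small.
have {}small := small approx_neq0 approx_mono.
have /choice[z zS] n : exists p, smvip_approx C Q f g B1 B2 A n.+1%:R^-1 p.
  exact: approx_neq0.
have [|p Sp _] := approx_cvg z small.
  apply/generalized_approximatingP; exists (fun n => n.+1%:R^-1).
  by split => //; exact: cvg_harmonic.
have Sunique q : smvip_sol C Q f g B1 B2 A q -> q = p.
  move=> Sq; apply: prod_hnorm_subr_eq0.
  apply/ler_addgt0Pr => r r0; rewrite add0r.
  by have [e e0] := small r r0; apply; exact: smvip_sol_approx.
exists p; split; first by apply/seteqP; split => [q /Sunique//|_ ->].
by move=> y yapp; have [q /Sunique->] := approx_cvg y small yapp.
Qed.
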